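(* Let $X$ be a compact Hausdorff space and let $\varphi_{0,\infty}=\{\varphi_j\}_{j=0}^{\infty}$ be a sequence of multivalued maps $\varphi_{j}:X\multimap X$, $j\in\mathbb{N}\cup\{0\}$. Then the inequalities $$h_{\mathfrak{p}}(\varphi_{0,\infty}) \leq h_{\mathfrak{m}}(\varphi_{0,\infty}) \leq h(\varphi_{0,\infty}),\qquad h(\varphi_{0,\infty}) \leq h_{\mathfrak{m}}(\varphi_{0,\infty}) + h_{\mathfrak{i}}(\varphi_{0,\infty})$$ hold for the parametric topological entropy $h$, the parametric pointwise entropies $h_{\mathfrak{p}}$, $h_{\mathfrak{m}}$, and the parametric branch entropy $h_{\mathfrak{i}}$.
   Context: A uniformity on a nonempty set $S$ is a nonempty family $\mathcal{U}$ of pseudometrics on $S$ such that: (U1) if $p_0,p_1\in\mathcal{U}$, then $\max\{p_0,p_1\}\in\mathcal{U}$; (U2) if $p$ is a pseudometric on $S$ such that for every $\varepsilon>0$ there exist $p_\varepsilon\in\mathcal{U}$ and $\delta>0$ with $p_\varepsilon(x,y)<\delta\Rightarrow p(x,y)<\varepsilon$ for all $x,y\in S$, then $p\in\mathcal{U}$; (U3) if $x\neq y$ in $S$, then $p(x,y)>0$ for some $p\in\mathcal{U}$. The induced topology has as base the balls $B_p(x,r)=\{y: p(x,y)<r\}$. A (nonempty) compact Hausdorff space $X$ carries a unique uniformity $\mathcal{U}$ inducing its topology, and this $\mathcal{U}$ is used below. A multivalued map $\varphi:X\multimap X$ assigns to each $x\in X$ a nonempty subset $\varphi(x)\subset X$.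 $\mathrm{Orb}_1(\varphi_{0,\infty})=X$ and, for $n\ge 2$, $\mathrm{Orb}_n(\varphi_{0,\infty})=\{(x_0,\ldots,x_{n-1})\in X^n: x_{i+1}\in\varphi_i(x_i),\ i=0,\ldots,n-2\}$. For $x\in X$, $\mathrm{Orb}_n(\varphi_{0,\infty},x)=\{(x_0,\ldots,x_{n-1})\in\mathrm{Orb}_n(\varphi_{0,\infty}): x_0=x\}$. For a pseudometric $p$ on a set $W$ and $\varepsilon>0$: $S\subset W$ is $(p,\varepsilon)$-separated if $p(x,y)>\varepsilon$ for all distinct $x,y\in S$; $R\subset W$ is $(p,\varepsilon)$-spanning in $Y\subset W$ if for every $y\in Y$ there is $x\in R$ with $p(x,y)\le\varepsilon$. For $p\in\mathcal{U}$, $p_n((x_i),(y_i))=\max_{0\le i\le n-1}p(x_i,y_i)$ on $X^n$. Let $s(\varphi_{0,\infty},p,\varepsilon,n)$ (resp. $s(\varphi_{0,\infty},p,\varepsilon,n,x)$) be the largest cardinality of a $(p_n,\varepsilon)$-separated subset of $\mathrm{Orb}_n(\varphi_{0,\infty})$ (resp. of $\mathrm{Orb}_n(\varphi_{0,\infty},x)$); these are finite. Define $$h(\varphi_{0,\infty})=\sup_{p\in\mathcal{U},\varepsilon>0}\limsup_{n\to\infty}\tfrac1n\log s(\varphi_{0,\infty},p,\varepsilon,n),$$ $$h_{\mathfrak{p}}(\varphi_{0,\infty})=\sup_{x\in X}\sup_{p\in\mathcal{U},\varepsilon>0}\limsup_{n\to\infty}\tfrac1n\log s(\varphi_{0,\infty},p,\varepsilon,n,x),$$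 $$h_{\mathfrak{m}}(\varphi_{0,\infty})=\sup_{p\in\mathcal{U},\varepsilon>0}\limsup_{n\to\infty}\tfrac1n\log\sup_{x\in X}s(\varphi_{0,\infty},p,\varepsilon,n,x).$$ The same values are obtained when largest cardinalities of separated sets are replaced by smallest cardinalities of $(p_n,\varepsilon)$-spanning sets contained in, and spanning in, $\mathrm{Orb}_n(\varphi_{0,\infty})$ (resp. $\mathrm{Orb}_n(\varphi_{0,\infty},x)$); $h$ also equals $\sup_{\mathcal A}\limsup_n\frac1n\log N(\varphi_{0,\infty},\mathcal{A},n)$, where $\mathcal A$ runs over open covers of $X$ and $N(\varphi_{0,\infty},\mathcal{A},n)$ is the minimal cardinality of a subfamily of $\{U_0\times\cdots\times U_{n-1}:U_i\in\mathcal{A}\}$ covering $\mathrm{Orb}_n(\varphi_{0,\infty})$. Define the pseudometric $p_n^b$ on $X$ by $$p^b_n(x,y)=\max\Big\{\sup_{\overline{x}\in\mathrm{Orb}_n(\varphi_{0,\infty},x)}\ \inf_{\overline{y}\in\mathrm{Orb}_n(\varphi_{0,\infty},y)}p_n(\overline{x},\overline{y}),\ \sup_{\overline{y}\in\mathrm{Orb}_n(\varphi_{0,\infty},y)}\ \inf_{\overline{x}\in\mathrm{Orb}_n(\varphi_{0,\infty},x)}p_n(\overline{y},\overline{x})\Big\}.$$ Let $s(\varphi_{0,\infty},p_n^b,\varepsilon)$ be the supremum of the cardinalities of $(p_n^b,\varepsilon)$-separated subsets of $X$, and let $\mathrm{Fin}(\kappa)=\kappa$ if $\kappa$ is a finite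 cardinal and $\mathrm{Fin}(\kappa)=\infty$ if $\kappa$ is an infinite cardinal. Define $$h_{\mathfrak{i}}(\varphi_{0,\infty})=\sup_{p\in\mathcal{U},\varepsilon>0}\limsup_{n\to\infty}\tfrac1n\log\mathrm{Fin}(s(\varphi_{0,\infty},p_n^b,\varepsilon))$$ (equivalently with the smallest cardinality of a $(p_n^b,\varepsilon)$-spanning set in $X$ in place of $s$). *)

(* Defs.v *)
From HB Require Import structures.
From mathcomp Require Import all_boot all_order all_algebra.
From mathcomp Require Import all_classical all_reals all_analysis.
Set Implicit Arguments.
Unset Strict Implicit.
Unset Printing Implicit Defensive.
Import Order.TTheory GRing.Theory Num.Theory.
Import numFieldNormedType.Exports.

Local Open Scope classical_set_scope.
Local Open Scope ring_scope.

Section Uniformity.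
Context {R : realType}.

Definition is_pseudometric {S : Type} (p : S -> S -> R) : Prop :=
  [/\ forall x y, 0 <= p x y,
      forall x, p x x = 0,
      forall x y, p x y = p y x
    & forall x y z, p x z <= p x y + p y z].

Definition is_uniformity {S : Type} (U : set (S -> S -> R)) : Prop :=
  [/\ U !=set0 /\ (forall p, U p -> is_pseudometric p),
      forall p0 p1, U p0 -> U p1 -> U (fun x y => Num.max (p0 x y) (p1 x y)),
      forall p, is_pseudometric p ->
        (forall e : R, 0 < e -> exists pe, exists d : R,
          [/\ U pe, 0 < d & forall x y, pe x y < d -> p x y < e]) ->
        U p
    & forall x y, x <> y -> exists2 p, U p & 0 < p x y].

Definition pball {S : Type} (p : S -> S -> R) (x : S) (r : R) : set S :=
  [set y | p x y < r].

Definition induces_topology {X : topologicalType} (U : set (X -> X -> R))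
    : Prop :=
  basis [set B : set X |
    exists p x (r : R), [/\ U p, 0 < r & B = pball p x r]].

Definition eps_separated {T : Type} (p : T -> T -> R) (e : R) (A : set T) : Prop :=
  forall x y, A x -> A y -> x <> y -> e < p x y.

(* [counting A] is the cardinality of [A], or +oo when [A] is infinite, so this
   is Fin of the supremum of the cardinalities of the (p, e)-separated subsets
   of [W]; it is their largest cardinality when that exists and is finite. *)
Definition sep_card {T : choiceType} (p : T -> T -> R) (e : R) (W : set T)
    : \bar R :=
  ereal_sup [set counting A | A in [set A | A `<=` W /\ eps_separated p e A]].

(* (1/n) log s_n; the junk value at n = 0 does not affect the limit superior. *)
Definition growth_rate (s : nat -> \bar R) : \bar R :=
  limn_esup (fun n => ((n%:R^-1)%:E * lne (s n))%E).

End Uniformity.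

Section Orbits.
Context {X : Type}.
Implicit Types phi : nat -> X -> set X.

Definition orb phi (n : nat) : set ('I_n -> X) :=
  [set w | forall i j : 'I_n, j = i.+1 :> nat -> phi i (w i) (w j)].
Arguments orb : clear implicits.

Definition orb_at phi (n : nat) (x : X) : set ('I_n -> X) :=
  [set w | orb phi n w /\ forall i : 'I_n, i = 0%N :> nat -> w i = x].

End Orbits.

Arguments orb {X} phi n.
Arguments orb_at {X} phi n x.

Section Entropies.
Context {R : realType} {X : topologicalType}.
Implicit Types (phi : nat -> X -> set X) (U : set (X -> X -> R)).

(* The initial value 0 is harmless since pseudometrics are nonnegative. *)
Definition pn (p : X -> X -> R) (n : nat) (v w : 'I_n -> X) : R :=
  \big[Num.max/0]_(i < n) p (v i) (w i).

(* For p in a uniformity inducing a compact topology, p is bounded, so for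
   nonempty-valued phi the real sup and inf are taken over nonempty bounded
   sets. *)
Definition pnb phi (p : X -> X -> R) (n : nat) (x y : X) : R :=
  Num.max
    (sup [set inf [set pn p v w | w in orb_at phi n y] | v in orb_at phi n x])
    (sup [set inf [set pn p w v | v in orb_at phi n x] | w in orb_at phi n y]).

Definition sup_scales U (f : (X -> X -> R) -> R -> \bar R) : \bar R :=
  ereal_sup [set f pe.1 pe.2 | pe in [set pe | U pe.1 /\ 0 < pe.2]].

Definition h_top U phi : \bar R :=
  sup_scales U (fun p e =>
    growth_rate (fun n => sep_card (@pn p n) e (orb phi n))).

Definition h_p U phi : \bar R :=
  ereal_sup [set sup_scales U (fun p e =>
      growth_rate (fun n => sep_card (@pn p n) e (orb_at phi n x)))
    | x in [set: X]].

Definition h_m U phi : \bar R :=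
  sup_scales U (fun p e =>
    growth_rate (fun n =>
      ereal_sup [set sep_card (@pn p n) e (orb_at phi n x)
        | x in [set: X]])).

Definition h_i U phi : \bar R :=
  sup_scales U (fun p e =>
    growth_rate (fun n => sep_card (pnb phi p n) e [set: X])).

End Entropies.

(* Main.v *)
Require Import Defs.
From mathcomp Require Import all_boot all_order all_algebra.
From mathcomp Require Import finmap lra.
From mathcomp Require Import all_classical all_reals all_analysis.

(** The first two inequalities are monotonicity: the orbits issued from one
    point are among all the orbits issued from all points, so their separated
    sets are no larger, and growth rates and suprema preserve this order.

    The third one rests on a covering argument at each fixed length n. Given p
    and e, put d = e / 6. A maximal (p_n^b, d)-separated set B in X is
    d-spanning for p_n^b, and for each x in B a maximal (p_n, d)-separated set
    C_x of orbits starting at x is d-spanning among these orbits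
    ([sep_card_spanning]). An orbit w starting at y is shadowed as follows: y
    is p_n^b-close to some x in B, so some orbit v starting at x is 2d-close
    to w, by the Hausdorff-like form of p_n^b ([branch_shadow]); then v is
    d-close to a member of C_x. So the union of the C_x is 3d-spanning for all
    orbits, and two distinct members of an e-separated set cannot be 3d-close
    to the same orbit since 6d <= e ([sep_card_le_spanning]). Hence
      s(p, e, n) <= (sup_x s(p, d, n, x)) * s(p_n^b, d)
    ([sep_card_orb_le]); when a factor on the right is infinite this is
    trivial, since both factors are at least 1. Logarithms turn the product
    into a sum of nonnegative terms, and the limit superior is subadditive
    ([growth_rateM_le]).

    Compactness of X enters only through the boundedness of p
    ([compact_pseudometric_bounded]), which makes the suprema in p_n^b
    genuine upper bounds. *)

Set Implicit Arguments.
Unset Strict Implicit.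
Unset Printing Implicit Defensive.
Import Order.TTheory GRing.Theory Num.Theory.
Local Open Scope classical_set_scope.
Local Open Scope ring_scope.

(** * Separated and spanning sets *)

Section Separation.
Context {R : realType} {T : choiceType}.
Implicit Types (p : T -> T -> R) (e : R) (W : set T) (s : seq T).

Lemma counting_seq s : uniq s -> counting [set` s] = (size s)%:R%:E :> \bar R.
Proof.
move=> us; rewrite /counting asboolT; last exact: finite_seq.
have fs : fset_set [set` s] =i s.
  move=> x; rewrite in_fset_set; last exact: finite_seq.
  by apply/idP/idP; rewrite inE.
by rewrite (perm_size (uniq_perm (fset_uniq _) us fs)).
Qed.

Lemma le_sep_card p e W s : uniq s -> [set` s] `<=` W ->
  eps_separated p e [set` s] -> ((size s)%:R%:E <= sep_card p e W)%E.
Proof.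
move=> us sW seps; rewrite -counting_seq//.
by apply: ereal_sup_ubound; exists [set` s].
Qed.

Lemma sep_card_ge1 p e W : W !=set0 -> (1%:E <= sep_card p e W)%E.
Proof.
move=> [x Wx]; have := @le_sep_card p e W [:: x].
apply => //.
- by move=> y /=; rewrite inE => /eqP ->.
- by move=> y z /=; rewrite !inE => /eqP -> /eqP ->.
Qed.

Lemma sep_card_subset p e W W' : W `<=` W' ->
  (sep_card p e W <= sep_card p e W')%E.
Proof.
move=> WW'; apply: ereal_sup_le => _ [A [AW As] <-].
by exists A => //; split => // x /AW /WW'.
Qed.

(** When the separated sets have bounded size, one of largest size exists, and
    it is spanning: a point far from all of it could be added to it. *)
Lemma sep_card_spanning p e W : (forall x, p x x <= e) ->
    (forall x y, p x y = p y x) -> (sep_card p e W < +oo)%E ->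
  exists s, [/\ [set` s] `<=` W, forall y, W y -> exists2 x, x \in s & p y x <= e
    & ((size s)%:R%:E <= sep_card p e W)%E].
Proof.
move=> prefl psym fin.
pose P n := `[< exists s, [/\ uniq s, [set` s] `<=` W,
  eps_separated p e [set` s] & size s = n] >].
have P0 : exists n, P n by exists 0%N; apply/asboolP; exists [::]; split.
have [N NP] : exists N : nat, (sep_card p e W < N%:R%:E)%E.
  have sep_ge0 : (0 <= sep_card p e W)%E by apply: (@le_sep_card _ _ _ [::]).
  exists (Num.truncn (fine (sep_card p e W))).+1.
  by rewrite -[ltLHS]fineK ?ge0_fin_numE// lte_fin truncnS_gt.
have Pbound n : P n -> (n <= N)%N.
  move=> /asboolP[s [us sW sepS sz]].
  have := le_lt_trans (le_sep_card us sW sepS) NP.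
  by rewrite lte_fin ltr_nat sz => /ltnW.
case: (ex_maxnP P0 Pbound) => _ /asboolP[s [us sW seps <-]] smax.
exists s; split => //; last exact: le_sep_card.
move=> y Wy; apply: contrapT => far.
have farE x : x \in s -> e < p y x.
  by move=> xs; rewrite ltNge; apply/negP => pxy; apply: far; exists x.
have ys : y \notin s.
  by apply/negP => /farE; rewrite ltNge prefl.
have /smax : P (size (y :: s)) by apply/asboolP; exists (y :: s); split => //=;
  [rewrite ys | move=> z /=; rewrite inE => /predU1P[->//|/sW] |
   move=> x z /=; rewrite !inE => /predU1P[->|xs] /predU1P[->|zs] // xz;
   [exact: farE | rewrite psym; exact: farE | exact: seps]].
by rewrite /= ltnn.
Qed.

(** Sending each point of a separated set to a spanning point near it is
    injective, as two points with the same image are d + d close. *)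
Lemma sep_card_le_spanning p d e W s :
    (forall x y, p x y = p y x) -> (forall x y z, p x z <= p x y + p y z) ->
    d + d <= e -> (forall y, W y -> exists2 x, x \in s & p y x <= d) ->
  (sep_card p e W <= (size s)%:R%:E)%E.
Proof.
move=> psym ptri dde span; apply: ge_ereal_sup => _ [A [AW Asep] <-].
have near y : exists x, W y -> x \in s /\ p y x <= d.
  have [Wy|nWy] := pselect (W y); last by exists y.
  by have [x] := span _ Wy; exists x.
have [f fP] := choice near.
have Asize (B : {fset T}) : [set` B] `<=` A -> (#|` B| <= size s)%N.
  move=> BA; rewrite -(size_map f) uniq_leq_size//.
    rewrite map_inj_in_uniq ?fset_uniq// => x y /BA Ax /BA Ay fxy.
    apply: contrapT => xy.
    have [_ xf] := fP _ (AW _ Ax); have [_ yf] := fP _ (AW _ Ay).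
    have := Asep _ _ Ax Ay xy; rewrite ltNge => /negP; apply.
    rewrite (le_trans (ptri _ (f x) _))// (le_trans _ dde)// lerD//.
    by rewrite fxy psym.
  by move=> _ /mapP[x /BA/AW/fP[fxs _] ->].
rewrite /counting; case: ifPn => [/asboolP finA|/asboolP infA].
  by rewrite lee_fin ler_nat Asize// fset_setK.
have [B BA] := infinite_set_fset (size s).+1 infA.
by rewrite ltnNge Asize.
Qed.

End Separation.

(** * Exponential growth rates *)

Section GrowthRate.
Context {R : realType}.
Implicit Types u v : nat -> \bar R.
Local Open Scope ereal_scope.

Lemma le_limn_esup u v : (forall n, u n <= v n) ->
  limn_esup u <= limn_esup v.
Proof.
move=> uv; rewrite !limn_esup_lim; apply: lee_lim; try exact: is_cvg_esups.
near=> n; apply: ge_ereal_sup => _ [k nk <-].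
by apply: le_trans (uv k) _; apply: ereal_sup_ubound; exists k.
Unshelve. all: by end_near.
Qed.

Lemma limn_esup_ge0 u : (forall n, 0 <= u n) -> 0 <= limn_esup u.
Proof.
move=> u0; rewrite limn_esup_lim; apply: lime_ge; first exact: is_cvg_esups.
near=> n; apply: le_trans (u0 n) _; apply: ereal_sup_ubound.
by exists n => /=.
Unshelve. all: by end_near.
Qed.

(** Nonnegativity excludes the indeterminate sum of opposite infinities. *)
Lemma limn_esupD_le u v : (forall n, 0 <= u n) -> (forall n, 0 <= v n) ->
  limn_esup (u \+ v) <= limn_esup u + limn_esup v.
Proof.
move=> u0 v0.
have def : limn (esups u) +? limn (esups v).
  by apply: ge0_adde_def; rewrite inE -limn_esup_lim limn_esup_ge0.
rewrite !limn_esup_lim -limeD//; try exact: is_cvg_esups.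
apply: lee_lim; first exact: is_cvg_esups.
  by apply: is_cvgeD => //; exact: is_cvg_esups.
near=> n; apply: ge_ereal_sup => _ [k nk <-].
by apply: leeD; apply: ereal_sup_ubound; exists k.
Unshelve. all: by end_near.
Qed.

Lemma le_lne (x y : \bar R) : x <= y -> lne x <= lne y.
Proof.
have [x0 _|x0 xy] := leP x 0; first by rewrite le0_lneNy// leNye.
have y0 := lt_le_trans x0 xy.
by rewrite lee_lne// in_itv/= leey ltW.
Qed.

Lemma le_growth_rate u v : (forall n, u n <= v n) ->
  growth_rate u <= growth_rate v.
Proof.
move=> uv; apply: le_limn_esup => n.
by rewrite lee_wpmul2l ?lee_fin ?invr_ge0 ?ler0n// le_lne.
Qed.

Lemma growth_rateM_le u v : (forall n, 1 <= u n) -> (forall n, 1 <= v n) ->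
  growth_rate (fun n => u n * v n) <= growth_rate u + growth_rate v.
Proof.
move=> u1 v1.
have pos (x : \bar R) : 1 <= x -> x \in `]0%R, +oo].
  by move=> x1; rewrite in_itv/= leey (lt_le_trans _ x1)// lte_fin.
apply: le_trans (limn_esupD_le _ _); last 2 first.
- by move=> n; rewrite mule_ge0 ?lne_ge0// lee_fin invr_ge0 ler0n.
- by move=> n; rewrite mule_ge0 ?lne_ge0// lee_fin invr_ge0 ler0n.
by apply: le_limn_esup => n /=; rewrite lneM ?pos// ge0_muleDr ?lne_ge0.
Qed.

End GrowthRate.

Lemma le_sup_scales {R : realType} {X : topologicalType}
    (U : set (X -> X -> R)) (f g : (X -> X -> R) -> R -> \bar R) :
  (forall p e, f p e <= g p e)%E -> (sup_scales U f <= sup_scales U g)%E.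
Proof.
move=> fg; apply: ge_ereal_sup => _ [pe Upe <-].
by apply: le_trans (fg _ _) _; apply: ereal_sup_ubound; exists pe.
Qed.

(** * Pseudometrics of the uniformity on a compact space *)

(** Distances to a fixed x0 are locally bounded because the unit balls of p
    are open, so compactness bounds them globally, and the triangle inequality
    through x0 doubles that bound. *)
Lemma compact_pseudometric_bounded {R : realType} {X : topologicalType}
    (U : set (X -> X -> R)) (p : X -> X -> R) :
  [set: X] !=set0 -> compact [set: X] -> induces_topology U ->
  is_pseudometric p -> U p -> exists M, forall x y, p x y <= M.
Proof.
move=> [x0 _] /compact_near_coveringP cX [opU _] [_ pxx psym ptri] Up.
have [|M [_ bound]] := cX R +oo%R (fun M y => p x0 y <= M) _.
  move=> x _.
  exists (pball p x 1, [set M | p x0 x + 1 <= M]); [split => /=|].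
  - apply: open_nbhs_nbhs; split; last by rewrite /pball/= pxx.
    by apply: opU; exists p, x, 1.
  - apply: nbhs_pinfty_ge; exact: num_real.
  - move=> [y M] /= [xy xM]; apply: le_trans (ptri _ x _) _.
    by apply: le_trans xM; rewrite lerD2l ltW.
(* The bound holds for all values above M, so a larger one has to be taken. *)
have {}bound y : p x0 y <= M + 1 by apply: (bound (M + 1)); rewrite ?ltrDl.
exists ((M + 1) + (M + 1)) => x y.
by rewrite (le_trans (ptri _ x0 _))// lerD// psym.
Qed.

(** * Orbits and the branch pseudometric *)

Section Branches.
Context {R : realType} {X : topologicalType}.
Variables (p : X -> X -> R) (phi : nat -> X -> set X).
Hypothesis p_pseudo : is_pseudometric p.
Hypothesis phi_nonempty : forall j x, phi j x !=set0.

Lemma pn_leP n (v w : 'I_n -> X) (c : R) :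
  reflect (0 <= c /\ forall i, p (v i) (w i) <= c) (pn p v w <= c).
Proof.
by apply: (iffP (bigmax_leP _ _ _ _)) => -[c0 H]; split => // i; exact: H.
Qed.

Lemma pn_is_pseudometric n : is_pseudometric (@pn R X p n).
Proof.
case: p_pseudo => p0 pxx psym ptri.
have pn0 (v w : 'I_n -> X) : 0 <= pn p v w by have/pn_leP[] := lexx (pn p v w).
have pn_ge (v w : 'I_n -> X) i : p (v i) (w i) <= pn p v w.
  by have/pn_leP[] := lexx (pn p v w).
split => //.
- move=> v; apply/eqP; rewrite eq_le pn0 andbT; apply/pn_leP; split => // i.
  by rewrite pxx.
- by move=> v w; rewrite /pn; apply: eq_bigr => i _; exact: psym.
- move=> u v w; apply/pn_leP; split; first by rewrite addr_ge0.
  by move=> i; rewrite (le_trans (ptri _ (v i) _))// lerD.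
Qed.

Lemma orb_at_nonempty n x : orb_at phi n x !=set0.
Proof.
have [f fP] := choice (fun jx : nat * X => phi_nonempty jx.1 jx.2).
pose g := fix g i := if i is j.+1 then f (j, g j) else x.
exists (fun i => g i); split => [i j ->|i ->] //; exact: (fP (_, _)).
Qed.

(** For n = 0 the empty orbit starts at every point of X vacuously, which is
    why X has to be nonempty. *)
Lemma orb_start n (w : 'I_n -> X) : [set: X] !=set0 -> orb phi n w ->
  exists x, orb_at phi n x w.
Proof.
move=> [x0 _]; case: n w => [|n] w worb; first by exists x0; split => // -[].
by exists (w ord0); split => // i i0; congr w; apply/val_inj.
Qed.

Lemma pnb_sym n x y : pnb phi p n x y = pnb phi p n y x.
Proof. exact: maxC. Qed.

Let near_set n (v : 'I_n -> X) (y : X) : set R :=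
  [set pn p v w | w in orb_at phi n y].

Let has_inf_near n (v : 'I_n -> X) (y : X) : has_inf (near_set v y).
Proof.
have [pn0 _ _ _] := pn_is_pseudometric n; split.
  by have [w ?] := orb_at_nonempty n y; exists (pn p v w), w.
by exists 0 => _ [w _ <-].
Qed.

(** Each orbit v starting at x is at distance 0 from an orbit starting at x,
    namely itself. *)
Lemma pnb_refl_le0 n x : pnb phi p n x x <= 0.
Proof.
have [pn0 pnxx _ _] := pn_is_pseudometric n.
suff H : sup [set inf (near_set v x) | v in orb_at phi n x] <= 0.
  by rewrite /pnb maxxx.
apply: ge_sup.
  by have [v ?] := orb_at_nonempty n x; exists (inf (near_set v x)), v.
move=> _ [v vx <-]; apply: ge_inf; first by have [] := has_inf_near v x.
by exists v.
Qed.

(** The infimum of the distances from v to the orbits starting at y is at most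
    d, but it need not be attained: the second d pays for approximating it.
    The bound M ensures that the supremum defining the branch pseudometric is
    taken over a bounded set, so that it dominates that infimum. *)
Lemma branch_shadow (M : R) n x y d (v : 'I_n -> X) :
    (forall a b, p a b <= M) -> 0 < d -> pnb phi p n x y <= d ->
    orb_at phi n x v ->
  exists2 w, orb_at phi n y w & pn p v w <= d + d.
Proof.
move=> pM d0 xy vx.
have [pn0 pnxx _ _] := pn_is_pseudometric n.
have infM (u : 'I_n -> X) : inf (near_set u y) <= Num.max 0 M.
  have [w wy] := orb_at_nonempty n y.
  apply: (@le_trans _ _ (pn p u w)).
    by apply: ge_inf; [have [] := has_inf_near u y|exists w].
  by apply/pn_leP; split=> [|i]; rewrite le_max ?lexx ?pM ?orbT.
have infd : inf (near_set v y) <= d.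
  apply: le_trans xy; rewrite /pnb le_max; apply/orP; left.
  apply: ub_le_sup; last by exists v.
  by exists (Num.max 0 M) => _ [u _ <-]; exact: infM.
have [_ [w wy <-] lt_w] := inf_adherent d0 (has_inf_near v y).
by exists w => //; rewrite (le_trans (ltW lt_w))// lerD.
Qed.

(** Shadowing an orbit costs d + d to reach a spanning starting point and d to
    reach a spanning orbit from there; separation at scale e needs twice this
    total, whence the factor 6. *)
Lemma sep_card_orb_le (M : R) (d e : R) n :
    [set: X] !=set0 -> (forall a b, p a b <= M) -> 0 < d -> 6%:R * d <= e ->
  (sep_card (@pn R X p n) e (orb phi n) <=
   ereal_sup [set sep_card (@pn R X p n) d (orb_at phi n x) | x in [set: X]] *
   sep_card (pnb phi p n) d [set: X])%E.
Proof.
move=> X0 pM d0 de; have [x0 _] := X0.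
set m := ereal_sup _; set b := sep_card (pnb _ _ _) _ _.
have [pn0 pnxx pnsym pntri] := pn_is_pseudometric n.
have b1 : (1%:E <= b)%E by apply: sep_card_ge1; exists x0.
have m_ge x : (sep_card (@pn R X p n) d (orb_at phi n x) <= m)%E.
  by apply: ereal_sup_ubound; exists x.
have m1 : (1%:E <= m)%E.
  exact: le_trans (sep_card_ge1 _ _ (orb_at_nonempty n x0)) (m_ge x0).
have m0 : (0 < m)%E by apply: lt_le_trans m1.
have b0 : (0 < b)%E by apply: lt_le_trans b1.
(* From here on both factors may be assumed finite, so that maximal separated
   sets exist. *)
have [boo|bfin] := eqVneq b +oo%E; first by rewrite boo gt0_muley// leey.
have [moo|mfin] := eqVneq m +oo%E; first by rewrite moo gt0_mulye// leey.
have [|||B [_ Bspan Bb]] := @sep_card_spanning _ _ (pnb phi p n) d setT.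
- by move=> x; rewrite (le_trans (pnb_refl_le0 n x))// ltW.
- exact: pnb_sym.
- by rewrite -/b ltey.
have spanning x : exists C : seq ('I_n -> X),
    (forall v, orb_at phi n x v -> exists2 u, u \in C & pn p v u <= d)
    /\ ((size C)%:R%:E <= m)%E.
  have [|||s [_ sspan ssz]] :=
    @sep_card_spanning _ _ (@pn R X p n) d (orb_at phi n x).
  - by move=> v; rewrite pnxx ltW.
  - exact: pnsym.
  - by rewrite (le_lt_trans (m_ge x))// ltey.
  by exists s; split => //; exact: le_trans ssz (m_ge x).
have [C CP] := choice spanning.
apply: (@le_trans _ _ (size (flatten [seq C x | x <- B]))%:R%:E).
  apply: (@sep_card_le_spanning _ _ _ (3%:R * d)) => //; first lra.
  move=> w worb.
  have [x wx] := orb_start X0 worb.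
  have [y yB xy] := Bspan x I.
  have [v vy wv] := branch_shadow pM d0 xy wx.
  have [u uC vu] := (CP y).1 _ vy.
  exists u; first by apply/flatten_mapP; exists y.
  have := pntri w v u; lra.
have mf : m \is a fin_num by rewrite ge0_fin_numE ?ltey ?ltW.
apply: (@le_trans _ _ ((size B)%:R%:E * m)%E); last first.
  by rewrite muleC lee_wpmul2l// ltW.
rewrite -(fineK mf) -EFinM lee_fin.
elim: B {Bspan Bb} => [|x B IH] /=; first by rewrite mul0r.
rewrite size_cat natrD -[in leRHS]add1n natrD mulrDl mul1r lerD//.
by rewrite -lee_fin fineK// (CP x).2.
Qed.

End Branches.

Theorem theorem5p9 (R : realType) (X : topologicalType)
  (X_nonempty : [set: X] !=set0)
  (X_compact : compact [set: X])
  (X_hausdorff : hausdorff_space X)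
  (U : set (X -> X -> R))
  (U_uniformity : is_uniformity U)
  (U_topology : induces_topology U)
  (phi : nat -> X -> set X)
  (phi_nonempty : forall j x, phi j x !=set0) :
  [/\ (h_p U phi <= h_m U phi)%E,
      (h_m U phi <= h_top U phi)%E
    & (h_top U phi <= h_m U phi + h_i U phi)%E].
Proof.
have [[_ U_pseudo] _ _ _] := U_uniformity.
split.
- apply: ge_ereal_sup => _ [x _ <-]; apply: le_sup_scales => p e.
  apply: le_growth_rate => n.
  by apply: ereal_sup_ubound; exists x.
- apply: le_sup_scales => p e; apply: le_growth_rate => n.
  by apply: ge_ereal_sup => _ [x _ <-]; apply: sep_card_subset => w [].
apply: ge_ereal_sup => _ [[p e] /= [Up e0] <-] /=.
have [M pM] := compact_pseudometric_bounded X_nonempty X_compact U_topology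
  (U_pseudo p Up) Up.
pose d := e / 6%:R.
have d0 : 0 < d by rewrite divr_gt0.
have de : 6%:R * d <= e by rewrite /d; lra.
have orb_le n := sep_card_orb_le (U_pseudo p Up) phi_nonempty n
  X_nonempty pM d0 de.
apply: le_trans (le_growth_rate orb_le) _.
have [x0 _] := X_nonempty.
apply: le_trans (growth_rateM_le _ _) _ => [n|n|].
- apply: (@le_trans _ _ (sep_card (@pn R X p n) d (orb_at phi n x0))).
    by apply: sep_card_ge1; exact: orb_at_nonempty.
  by apply: ereal_sup_ubound; exists x0.
- exact: sep_card_ge1.
by apply: leeD; apply: ereal_sup_ubound; exists (p, d).
Qed.
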